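(* Let $\mathcal{R}_{n,*}(y)=\sum_{k\ge0}R_{n,k}y^k$ for $n\ge0$, with $R_{n,k}$ as in the context. Then $\{\mathcal{R}_{n,*}(y)\}_{n\ge0}$ is a generalized Sturm sequence; in particular, every polynomial $\mathcal{R}_{n,*}(y)$ is real-rooted.
   Context: For $n\ge1$, $S_n$ is the set of permutations of $\{0,\dots,n-1\}$ in one-line notation. A 3-dimensional permutation of length $n$ is a pair $\Pi=(\pi^2,\pi^3)$ of elements of $S_n$ (for $n=0$, the empty permutation); its elements are the columns $\Pi_j=(\pi^2_j,\pi^3_j)^T$ with level $\max\{\pi^2_j,\pi^3_j\}$. $\Pi$ is canonical if $\pi^2=01\cdots(n-1)$. $R_{n,k}$ is the number of canonical 3-dimensional permutations of length $n$ in which exactly $k$ distinct level values are each attained by two elements ($R_{0,0}=1$, $R_{0,k}=0$ for $k\ge1$). A polynomial is real-rooted if all its roots are real (nonzero constants count as real-rooted). For real-rooted polynomials $f,g$ with nonnegative coefficients, with roots $r_1\ge r_2\ge\cdots$ of $f$ and $s_1\ge s_2\ge\cdots$ of $g$, write $g\preccurlyeq f$ if either $\deg f=\deg g=n$ and $s_n\le r_n\le s_{n-1}\le r_{n-1}\le\cdots\le s_1\le r_1$, or $\deg f=\deg g+1=n$ and $r_n\le s_{n-1}\le r_{n-1}\le\cdots\le s_1\le r_1$. By convention $a\preccurlyeq bx+c$ for all real $a,b,c$, and $f\preccurlyeq 0$, $0\preccurlyeq f$ for every real-rooted $f$. A polynomial is standard if it is $0$ or has positive leading coefficient. A sequence $\{f_n\}_{n\ge0}$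 of standard polynomials is a generalized Sturm sequence if every $f_n$ is real-rooted and $f_n\preccurlyeq f_{n+1}$ for all $n\ge0$. *)

(* Defs.v *)
From HB Require Import structures.
From mathcomp Require Import all_boot all_order all_algebra all_fingroup.
From mathcomp Require Import reals.
From mathcomp Require Import complex.

Set Implicit Arguments.
Unset Strict Implicit.
Unset Printing Implicit Defensive.

Import Order.TTheory GRing.Theory Num.Theory.
Local Open Scope ring_scope.

(* The pair (pi^2, pi^3); the entries are 0, ..., n-1 and ['S_0] has a single
   element, so [perm3 0] consists of the empty permutation only. *)
Definition perm3 (n : nat) := ('S_n * 'S_n)%type.

Definition level (n : nat) (P : perm3 n) (j : 'I_n) : nat :=
  maxn (P.1 j) (P.2 j).

Definition canonical (n : nat) (P : perm3 n) : bool :=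
  [forall j : 'I_n, P.1 j == j].

(* Every level is < n, so letting l range over ['I_n] loses nothing. *)
Definition double_levels (n : nat) (P : perm3 n) : nat :=
  #|[set l : 'I_n | #|[set j : 'I_n | level P j == l]| == 2]|.

Definition Rnum (n k : nat) : nat :=
  #|[set P : perm3 n | canonical P & double_levels P == k]|.

(* [double_levels P <= n], hence [Rnum n k = 0] for k > n and the sum over all
   k >= 0 is the sum over k <= n. *)
Definition Rpoly (R : realType) (n : nat) : {poly R} :=
  \sum_(k < n.+1) (Rnum n k)%:R *: 'X^k.

(* All complex roots are real; the zero polynomial is not real-rooted. *)
Definition real_rooted (R : realType) (p : {poly R}) : Prop :=
  forall z : complex R, root (map_poly (real_complex R) p) z ->
    z \is Num.real.

(* For p != 0 that splits over R, r lists the roots of p in weakly decreasing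
   order, with multiplicity. *)
Definition roots_desc (R : realType) (p : {poly R}) (r : seq R) : Prop :=
  sorted >=%R r /\ p = lead_coef p *: \prod_(x <- r) ('X - x%:P).

(* Root lists are indexed from 0.  The two inequalities cover both degree cases:
   the chain starts (on the left) with s_n <= r_n when deg f = deg g = n, and
   with r_n <= s_(n-1) when deg f = deg g + 1 = n. *)
Definition interlaced (R : realType) (g f : {poly R}) : Prop :=
  [/\ real_rooted g /\ real_rooted f,
      g \is a polyOver Num.nneg /\ f \is a polyOver Num.nneg,
      size f = size g \/ size f = (size g).+1 &
      exists s r : seq R,
        [/\ roots_desc g s, roots_desc f r,
            forall i, (i < size s)%N -> s`_i <= r`_i &
            forall i, (i.+1 < size r)%N -> r`_i.+1 <= s`_i]].

Definition preceq (R : realType) (g f : {poly R}) : Prop :=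
  [\/ interlaced g f,
      exists a b c : R, g = a%:P /\ f = b *: 'X + c%:P,
      real_rooted g /\ f = 0 |
      g = 0 /\ real_rooted f].

Definition standard (R : realType) (p : {poly R}) : Prop :=
  p = 0 \/ 0 < lead_coef p.

Definition generalized_sturm (R : realType) (f : nat -> {poly R}) : Prop :=
  [/\ forall n, standard (f n),
      forall n, real_rooted (f n) &
      forall n, preceq (f n) (f n.+1)].

(* Main.v *)
(** Inserting the largest entry [n] into a permutation of length [n] with [k]
    double levels, either as a fixed point or just after one of its elements,
    gives 1 + 2k permutations with [k] double levels and n - 2k with [k+1].
    Hence R_(n+1) = (1 + n y) R_n + 2 y (1 - y) R_n'.  If R_n has simple negative
    roots, then R_(n+1) is positive at 0 and its signs alternate along the roots
    of R_n, because there it equals 2 y (1 - y) R_n'; this locates all the roots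
    of R_(n+1), one more near minus infinity when the degree increases. *)

Require Import Defs.
From mathcomp Require Import all_boot all_order all_algebra all_fingroup.
From mathcomp Require Import reals.
From mathcomp Require Import complex polyrcf zify ring lra.

Set Implicit Arguments.
Unset Strict Implicit.
Unset Printing Implicit Defensive.

Import Order.TTheory GRing.Theory Num.Theory.
Local Open Scope ring_scope.

(** * Reduction to a statistic on single permutations *)

(** The level of column [j] once the first permutation is the identity, as [canonicalE] forces. *)
Definition plevel n (s : 'S_n) (j : 'I_n) : nat := maxn j (s j).

Definition level_count n (s : 'S_n) (l : nat) : nat :=
  (\sum_(j < n) (plevel s j == l))%N.

Definition double_count n (s : 'S_n) : nat :=
  (\sum_(l < n) (level_count s l == 2))%N.

Lemma canonicalE n (P : perm3 n) : canonical P = (P.1 == 1%g).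
Proof.
apply/forallP/eqP => [h|-> j]; last by rewrite perm1.
by apply/permP => j; rewrite perm1; apply/eqP.
Qed.

Lemma card_set_sum (T : finType) (p : pred T) :
  #|[set x | p x]| = (\sum_x p x)%N.
Proof.
rewrite cardsE -sum1_card big_mkcond; apply: eq_bigr => x _.
by rewrite unfold_in; case: (p x).
Qed.

Lemma double_levelsE n (s : 'S_n) : double_levels (1%g, s) = double_count s.
Proof.
rewrite /double_levels card_set_sum; apply: eq_bigr => l _.
rewrite card_set_sum /level_count.
by under eq_bigr do rewrite /level perm1 /=.
Qed.

Lemma RnumE n k : Rnum n k = #|[set s : 'S_n | double_count s == k]|.
Proof.
have inj1 : injective (fun s : 'S_n => (1%g : 'S_n, s)) by move=> s t [].
rewrite /Rnum -(card_imset _ inj1).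
apply: eq_card => -[u s]; rewrite !inE canonicalE /=; apply/andP/imsetP.
  case=> /eqP -> /eqP <-; exists s => //.
  by rewrite inE double_levelsE.
by case=> t; rewrite inE => /eqP <- [-> ->]; rewrite double_levelsE.
Qed.

(** A column [j] of level [l] has [j = l] or [s j = l], and each equation has at most one
    solution. *)
Lemma level_count_le2 n (s : 'S_n) l : (level_count s l <= 2)%N.
Proof.
rewrite /level_count.
have le (f : 'I_n -> nat) : injective f -> (\sum_(j < n) (f j == l) <= 1)%N.
  move=> f_inj; rewrite -card_set_sum; apply/card_le1_eqP => x y.
  by rewrite !inE => /eqP <- /eqP/f_inj.
apply: (@leq_trans (\sum_(j < n) (j == l :> nat) + \sum_(j < n) (s j == l :> nat))).
  rewrite -big_split /=; apply: leq_sum => j _; rewrite /plevel.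
  by rewrite maxnE; lia.
by rewrite -(addn1 1) leq_add // le // => x y; [move/ord_inj|move/ord_inj/perm_inj].
Qed.

Lemma plevel_lt n (s : 'S_n) j : (plevel s j < n)%N.
Proof. by rewrite gtn_max !ltn_ord. Qed.

(** Grouping columns by level, each double level contributes its two columns. *)
Lemma sum_double_level n (s : 'S_n) :
  (\sum_(j < n) (level_count s (plevel s j) == 2) = (double_count s).*2)%N.
Proof.
rewrite (partition_big (fun j => Ordinal (plevel_lt s j)) xpredT) //=.
rewrite /double_count -muln2 big_distrl /=; apply: eq_bigr => l _.
rewrite (eq_bigr (fun=> (level_count s l == 2%N) : nat)); last first.
  by move=> j /eqP <-.
rewrite sum_nat_const mulnC; case: eqP => [e|_]; last by rewrite !mul0n.
by rewrite !mul1n -e /level_count -card_set_sum cardsE.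
Qed.

Lemma double_count_le n (s : 'S_n) : ((double_count s).*2 <= n)%N.
Proof.
rewrite -sum_double_level -[leqRHS]card_ord -sum1_card.
by apply: leq_sum => j _; exact: leq_b1.
Qed.

(** * Insertion of the largest entry *)

(* Inserts the largest entry [n] into a cycle of [s], just after [j]; when [j]
   is [n] itself, it becomes a fixed point. *)
Definition insert_max n (j : 'I_n.+1) (s : 'S_n) : 'S_n.+1 :=
  (tperm j ord_max * lift_perm ord_max ord_max s)%g.

(** The position [j] is recovered as the preimage of [ord_max], after which the transposition
    cancels; injectivity suffices because both sides have (n+1)! elements. *)
Lemma insert_max_bij n :
  bijective (fun js : 'I_n.+1 * 'S_n => insert_max js.1 js.2).
Proof.
apply: inj_card_bij; last first.
  by rewrite card_prod !card_Sn card_ord factS.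
move=> [j s] [k t] /= e.
have jk : j = k.
  have hj : insert_max j s j = ord_max by rewrite permM tpermL lift_perm_id.
  have hk : insert_max k t k = ord_max by rewrite permM tpermL lift_perm_id.
  by apply: (@perm_inj _ (insert_max j s)); rewrite hj e hk.
move: e; rewrite jk => /mulgI e; congr (_, _); apply/permP => i.
by apply: (@lift_inj _ ord_max); rewrite -!(lift_perm_lift ord_max) e.
Qed.

Lemma sum_lift_max n (F : 'I_n.+1 -> nat) :
  (\sum_i F i = \sum_(i < n) F (lift ord_max i) + F ord_max)%N.
Proof.
rewrite big_ord_recr /=; congr (_ + _)%N; apply: eq_bigr => i _; congr F.
by apply: ord_inj; rewrite lift_max.
Qed.

Lemma plevel_lift_perm n (s : 'S_n) i :
  plevel (lift_perm ord_max ord_max s) (lift ord_max i) = plevel s i.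
Proof. by rewrite /plevel lift_perm_lift !lift_max. Qed.

(** The new column is the only one of level [n], and the others keep their levels. *)
Lemma double_count_fixed n (s : 'S_n) :
  double_count (insert_max ord_max s) = double_count s.
Proof.
have cnt l : level_count (insert_max ord_max s) l = (level_count s l + (n == l))%N.
  rewrite /insert_max tperm1 mul1g /level_count sum_lift_max.
  congr (_ + _)%N; first by apply: eq_bigr => i _; rewrite plevel_lift_perm.
  by rewrite /plevel lift_perm_id maxnn.
rewrite /double_count big_ord_recr /= cnt.
have -> : level_count s n = 0%N.
  by apply: big1 => j _; rewrite ltn_eqF // plevel_lt.
rewrite eqxx /= addn0; apply: eq_bigr => l _.
by rewrite cnt (gtn_eqF (ltn_ord l)) addn0.
Qed.

(* Inserting [n] after [i] removes one column of level [plevel s i] and creates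
   two columns of level [n]. *)
Lemma double_count_insert n (s : 'S_n) (i : 'I_n) :
  (double_count (insert_max (lift ord_max i) s)
     + (level_count s (plevel s i) == 2) = (double_count s).+1)%N.
Proof.
set t := insert_max _ s.
have ti : t (lift ord_max i) = ord_max by rewrite permM tpermL lift_perm_id.
have tm : t ord_max = lift ord_max (s i) by rewrite permM tpermR lift_perm_lift.
have tk k : k != i -> t (lift ord_max k) = lift ord_max (s k).
  move=> ki; rewrite permM tpermD ?lift_perm_lift //; last exact: neq_lift.
  by rewrite (inj_eq (@lift_inj _ _)) eq_sym.
have pm : plevel t ord_max = n.
  by rewrite /plevel tm lift_max; apply/maxn_idPl; apply: ltnW.
have pi : plevel t (lift ord_max i) = n.
  by rewrite /plevel ti lift_max; apply/maxn_idPr; apply: ltnW.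
have pk k : k != i -> plevel t (lift ord_max k) = plevel s k.
  by move=> ki; rewrite /plevel tk // !lift_max.
have cnt_lt l : (l < n)%N ->
    (level_count t l + (plevel s i == l) = level_count s l)%N.
  move=> ln; rewrite /level_count sum_lift_max pm gtn_eqF // addn0.
  rewrite (bigD1 i) //= pi gtn_eqF // add0n addnC [RHS](bigD1 i) //=.
  by congr (_ + _)%N; apply: eq_bigr => k /pk ->.
have cnt_n : level_count t n = 2%N.
  rewrite /level_count sum_lift_max pm eqxx (bigD1 i) //= pi eqxx.
  by rewrite big1 // => k /pk ->; rewrite ltn_eqF // plevel_lt.
rewrite /double_count big_ord_recr /= cnt_n eqxx addn1 addSn; congr S.
pose l0 := Ordinal (plevel_lt s i).
rewrite (bigD1 l0) //= [RHS](bigD1 l0) //=.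
have := cnt_lt _ (plevel_lt s i); rewrite eqxx => e.
have := level_count_le2 s (plevel s i); rewrite -e => le2.
(* This level had at most two columns and has lost one, so it is not double in [t]; whether it was
   double in [s] is the boolean of the statement. *)
have -> : (level_count t (plevel s i) == 2%N) = false by lia.
rewrite add0n addnC; congr (_ + _)%N; apply: eq_bigr => l ll0.
rewrite -(cnt_lt l) ?ltn_ord //.
suff -> : (plevel s i == l) = false by rewrite addn0.
by apply: contraNF ll0 => /eqP e'; apply/eqP/ord_inj.
Qed.

(** * Generating polynomial and its recurrence *)

Section Recurrence.
Variable R : realType.

Lemma Rpoly_sum n : Rpoly R n = \sum_(s : 'S_n) 'X^(double_count s).
Proof.
have lt (s : 'S_n) : (double_count s < n.+1)%N.
  by have := double_count_le s; rewrite -addnn; lia.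
rewrite (partition_big (fun s => Ordinal (lt s)) xpredT) //=.
apply: eq_bigr => k _; rewrite RnumE.
rewrite (eq_bigr (fun=> 'X^k)); last by move=> s /eqP <-.
by rewrite sumr_const scaler_nat cardsE.
Qed.

Lemma RpolyS n : Rpoly R n.+1 =
  (1 + n%:R *: 'X) * Rpoly R n + (1 - 'X) * 'X * (Rpoly R n)^`() *+ 2.
Proof.
rewrite !Rpoly_sum (reindex _ (onW_bij _ (insert_max_bij n))) /=.
rewrite -(pair_bigA _ (fun j s => 'X^(double_count (insert_max j s)))) /=.
rewrite exchange_big /=.
rewrite raddf_sum !big_distrr -sumrMnl -big_split /=.
apply: eq_bigr => s _; set k := double_count s.
rewrite big_ord_recr /=.
rewrite (eq_bigr (fun i =>
    'X^(double_count (insert_max (lift ord_max i) s)))); last first.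
  move=> i _; congr ('X^(double_count (insert_max _ _))).
  by apply: ord_inj; rewrite lift_max.
rewrite double_count_fixed -/k.
pose b i := level_count s (plevel s i) == 2%N.
(* Position [i] contributes ['X^k] when [b i] holds and ['X^(k.+1)] otherwise. By
   [sum_double_level], [b] holds [2k] times, and the factor [k] produces the derivative. *)
rewrite (eq_bigr (fun i => 'X^(k.+1) + ((1 - 'X) * 'X^k) *+ b i)); last first.
  move=> i _; have := double_count_insert s i; rewrite -/k -/(b i).
  case: (b i); last by rewrite addn0 => ->; rewrite addr0.
  by rewrite addn1 => -[->]; rewrite exprS mulr1n; ring.
rewrite big_split /= sumr_const card_ord sumrMnr sum_double_level -/k.
rewrite derivXn.
case: k => [|k].
  by rewrite double0 mulr0n expr0 scaler_nat; ring.
rewrite -muln2 scaler_nat /= !exprS; ring.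
Qed.

Lemma Rpoly_nneg n : Rpoly R n \is a polyOver Num.nneg.
Proof.
apply/polyOverP => i; rewrite coef_sum nnegrE; apply: sumr_ge0 => k _.
by rewrite coefZ coefXn -natrM ler0n.
Qed.

Lemma Rpoly_horner0 n : (Rpoly R n).[0] = 1.
Proof.
elim: n => [|n IHn]; last by rewrite RpolyS !hornerE IHn /= !addr0.
rewrite Rpoly_sum (eq_bigr (fun=> 1)) => [|s _].
  by rewrite sumr_const card_Sn hornerC.
by rewrite /double_count big_ord0.
Qed.

Lemma Rpoly_neq0 n : Rpoly R n != 0.
Proof.
apply: contra_eq_neq (Rpoly_horner0 n) => ->.
by rewrite horner0 eq_sym oner_eq0.
Qed.

Lemma size_Rpoly_le n : (size (Rpoly R n) <= n./2.+1)%N.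
Proof.
rewrite Rpoly_sum; apply: (leq_trans (size_sum _ _ _)).
apply/bigmax_leqP => s _; rewrite size_polyXn ltnS.
by rewrite -[leqLHS]doubleK half_leq // double_count_le.
Qed.

(* By [RpolyS], the coefficient of X^(d+1) is [n - 2d] times that of X^d. *)
Lemma Rpoly_top_coef n : odd n ->
  (Rpoly R n.+1)`_(n./2.+1) = (Rpoly R n)`_(n./2).
Proof.
move=> n_odd; set d := n./2; have e : n = d.*2.+1 by rewrite /d; lia.
have p0 : (Rpoly R n)`_d.+1 = 0 by rewrite nth_default // size_Rpoly_le.
have -> : Rpoly R n.+1 = Rpoly R n + (n%:R *: Rpoly R n) * 'X
    + ((Rpoly R n)^`() *+ 2) * 'X - ((Rpoly R n)^`() *+ 2) * 'X * 'X.
  by rewrite RpolyS -!mul_polyC; ring.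
move: (Rpoly R n) p0 => p p0; clearbody d.
rewrite !(coefD, coefN, coefMX, coefZ, coefMn, coef_deriv) /= p0 e.
case: d {e} p0 => [|k] p0 /=; first by rewrite double0; ring.
by rewrite -addnn; ring.
Qed.
End Recurrence.

(** * Sign changes and roots over a real closed field *)

Section Interlacing.
Variable R : rcfType.

(** The intermediate value theorem gives a root between consecutive points. Dropping the first point
    reverses the sign pattern, so the induction passes to [- q]. *)
Lemma alternating_roots (t : seq R) (q : {poly R}) (a : R) :
  path >%R a t ->
  (forall i, (i <= size t)%N -> 0 < (-1) ^+ i * q.[(a :: t)`_i]) ->
  exists r : seq R, [/\ size r = size t, all (root q) r &
    forall i, (i < size t)%N -> t`_i < r`_i < (a :: t)`_i].
Proof.
elim: t q a => [|b t IHt] q a /=; first by move=> *; exists [::].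
case/andP=> ba pt alt.
have [||r [sr rr lr]] := IHt (- q) b => //.
  by move=> i it; have := alt i.+1 it; rewrite /= exprS hornerN; lra.
have [|x xab rx] := @poly_ivtoo R q b a (ltW ba).
  have /= := alt 0%N isT; have /= := alt 1%N isT.
  by rewrite expr0 expr1; nra.
exists (x :: r); split => /=; first by rewrite sr.
  by rewrite rx; apply: sub_all rr => y; rewrite rootN.
by move=> [|i] /=; [move: xab; rewrite in_itv | move=> /lr].
Qed.

(** The polynomial (-1)^deg(p) p(-X) has positive leading coefficient, so it is positive far to the
    right. *)
Lemma minfty_sign (p : {poly R}) (a : R) : 0 < lead_coef p ->
  exists2 x, x < a & 0 < (-1) ^+ (size p).-1 * p.[x].
Proof.
move=> lp; have [s1|s1] := leqP (size p) 1.
  exists (a - 1); first by lra.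
  move: lp; rewrite (size1_polyC s1) hornerC lead_coefC size_polyC.
  by case: (_ != 0); rewrite /= expr0 mul1r.
pose q := (-1) ^+ (size p).-1 *: (p \Po (- 'X)).
have lq : 0 < lead_coef q.
  rewrite lead_coefZ lead_coef_comp ?size_polyN ?size_polyX //.
  by rewrite lead_coefN lead_coefX mulrCA -exprMn mulrNN mulr1 expr1n mulr1.
have [m hm] := poly_pinfty_gt_lc lq.
(* The bound [1 - a] keeps the point at most [a - 1], hence strictly below [a]. *)
exists (- (Num.max m (1 - a))).
  by rewrite ltrNl lt_max; apply/orP; right; lra.
have := hm (Num.max m (1 - a)); rewrite le_max lexx => /(_ isT) /(lt_le_trans lq).
by rewrite hornerZ horner_comp !hornerE.
Qed.

(** At a root [x] the derivative is [c] times the product of [x - y] over the other roots; the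
    negative factors come from the [i] larger roots. *)
Lemma deriv_sign (c : R) (s : seq R) i : 0 < c -> sorted >%R s ->
  (i < size s)%N ->
  0 < (-1) ^+ i * (c *: \prod_(x <- s) ('X - x%:P))^`().[s`_i].
Proof.
move=> c0 ss ilt; set x := s`_i.
have es : s = take i s ++ x :: drop i.+1 s by rewrite -drop_nth // cat_take_drop.
pose u := take i s; pose v := drop i.+1 s.
have ->: (c *: \prod_(x <- s) ('X - x%:P))^`().[x] =
    c * ((\prod_(y <- u) (x - y)) * (\prod_(y <- v) (x - y))).
  rewrite es big_cat big_cons /= -/u -/v mulrCA.
  rewrite derivZ derivM derivXsubC mul1r hornerZ hornerD !hornerM hornerXsubC.
  rewrite subrr mul0r addr0.
  by rewrite !horner_prod; congr (_ * (_ * _));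
    apply: eq_bigr => y _; rewrite hornerXsubC.
move: ss; rewrite es sorted_pairwise; last exact: rev_trans lt_trans.
rewrite pairwise_cat /= => /and3P[auv _ /andP[av _]].
have pv : 0 < \prod_(y <- v) (x - y).
  rewrite big_seq; apply: prodr_gt0 => y yv.
  by rewrite subr_gt0; apply: (allP av).
have pu : 0 < (-1) ^+ i * \prod_(y <- u) (x - y).
  have -> : i = size u by rewrite size_takel // ltnW.
  have: all (> x) u by move: auv; rewrite allrel_consr => /andP[].
  elim: u {auv} => [|y u IHu] /=; first by rewrite big_nil mulr1.
  case/andP=> xy /IHu; rewrite big_cons exprS mulrACA => pu.
  by rewrite mulr_gt0 // mulN1r opprB subr_gt0.
rewrite [ltRHS](_ : _ = c * ((-1) ^+ i * \prod_(y <- u) (x - y))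
  * \prod_(y <- v) (x - y)); last by ring.
by rewrite mulr_gt0 // mulr_gt0.
Qed.
End Interlacing.

(** * Inductive location of the roots *)

Section Sturm.
Variable R : realType.

(** The strict order on [s] encodes simplicity of the roots. *)
Definition simple_neg_roots (p : {poly R}) (s : seq R) :=
  [/\ sorted >%R s, all (< 0) s, 0 < lead_coef p &
      p = lead_coef p *: \prod_(x <- s) ('X - x%:P)].

Lemma size_simple_neg_roots p s : simple_neg_roots p s -> size p = (size s).+1.
Proof.
by case=> _ _ lp ->; rewrite size_scale ?gt_eqF // size_prod_XsubC.
Qed.

Lemma RpolyS_alternates n s : simple_neg_roots (Rpoly R n) s ->
  forall i, (i <= size s)%N -> 0 < (-1) ^+ i * (Rpoly R n.+1).[(0 :: s)`_i].
Proof.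
case=> ss sneg lp es [_|i ilt] /=; first by rewrite Rpoly_horner0 expr0 mulr1.
have := deriv_sign lp ss ilt; rewrite -es.
have : root (Rpoly R n) s`_i.
  by rewrite es rootZ ?gt_eqF // root_prod_XsubC mem_nth.
move: (allP sneg _ (mem_nth 0 ilt)); move: (s`_i) => x /= x0 /rootP px dp.
rewrite RpolyS !(hornerD, hornerN, hornerM, hornerMn, hornerX) (hornerC 1) px mulr0 add0r exprS.
set e := (-1) ^+ i in dp *; set p' := _.[x] in dp *.
(* Since [x < 0], the factor [2x(1 - x)] is negative; its sign absorbs the extra -1 of the exponent
   [i.+1]. *)
rewrite [ltRHS](_ : _ = (e * p') * ((1 - x) * - x *+ 2)); last by ring.
rewrite mulr_gt0 // pmulrn_lgt0 // mulr_gt0 //; lra.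
Qed.

(* For odd [n] the degree increases; the extra point, close to minus infinity,
   catches the new smallest root. *)
Lemma sign_change_points n s : size s = n./2 -> simple_neg_roots (Rpoly R n) s ->
  exists t : seq R, [/\ size t = (n.+1)./2, path >%R 0 t,
    forall i, (i < size s)%N -> t`_i = s`_i &
    forall i, (i <= size t)%N -> 0 < (-1) ^+ i * (Rpoly R n.+1).[(0 :: t)`_i]].
Proof.
move=> sz srs; have alt := RpolyS_alternates srs.
have [ss sneg lp es] := srs.
have pth : path >%R 0 s by rewrite path_sortedE ?sneg //; exact: rev_trans lt_trans.
have [n_odd|n_even] := boolP (odd n); last first.
  by exists s; split=> //; rewrite sz; lia.
have top : (Rpoly R n.+1)`_(n./2.+1) = lead_coef (Rpoly R n).
  by rewrite Rpoly_top_coef // lead_coefE (size_simple_neg_roots srs) sz.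
have szq : size (Rpoly R n.+1) = n./2.+2.
  apply/eqP; rewrite eqn_leq; apply/andP; split.
    by apply: leq_trans (size_Rpoly_le _ _) _; lia.
  rewrite ltnNge; apply: contraL lp => /leq_sizeP/(_ _ (leqnn _)) h.
  by rewrite -top h ltxx.
have lq : 0 < lead_coef (Rpoly R n.+1) by rewrite lead_coefE szq top.
(* The degree [n./2.+1] is also the index of [x] in [0 :: rcons s x], so the sign at [x] continues
   the alternation. *)
have [x xlt altx] := minfty_sign (last 0 s) lq.
exists (rcons s x); split.
- rewrite size_rcons sz; lia.
- by rewrite rcons_path pth.
- by move=> i ilt; rewrite nth_rcons ilt.
- move=> i; rewrite size_rcons -rcons_cons nth_rcons /= ltnS leq_eqVlt ltnS.
  case/orP => [/eqP->|ilt]; last by rewrite ilt alt.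
  by rewrite ltnn eqxx; move: altx; rewrite szq sz.
Qed.

(** Each gap between consecutive points of [0 :: t] holds a root, and [t] extends [s], so the new
    roots interlace the old ones. *)
Lemma Rpoly_interlacing_step n s : size s = n./2 -> simple_neg_roots (Rpoly R n) s ->
  exists r : seq R, [/\ size r = (n.+1)./2, simple_neg_roots (Rpoly R n.+1) r,
    forall i, (i < size s)%N -> s`_i <= r`_i &
    forall i, (i.+1 < size r)%N -> r`_i.+1 <= s`_i].
Proof.
move=> sz srs; have [t [szt pt ts alt]] := sign_change_points sz srs.
have [r [szr rr rt]] := alternating_roots pt alt.
have lo i : (i < size t)%N -> t`_i < r`_i by move=> /rt /andP[].
have hi i : (i < size t)%N -> r`_i < (0 :: t)`_i by move=> /rt /andP[].
have sr : sorted >%R r.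
  apply/(sortedP 0) => i; rewrite szr => ilt.
  by apply: lt_trans (hi _ ilt) (lo _ (ltnW ilt)).
have rneg : all (< 0) r.
  apply/(all_nthP 0) => i; rewrite szr => ilt; apply: lt_le_trans (hi _ ilt) _.
  case: i ilt => [//|i] /ltnW ilt /=; apply: ltW.
  move: pt; rewrite path_sortedE; last exact: rev_trans lt_trans.
  by case/andP=> /allP/(_ _ (mem_nth 0 ilt)).
have ur : uniq r by apply: sorted_uniq sr; [exact: rev_trans lt_trans | exact: ltxx].
(* The degree bound matches the number of distinct roots found, so [r] lists all the roots. *)
have szq : size (Rpoly R n.+1) = (size r).+1.
  apply/eqP; rewrite eqn_leq szr szt size_Rpoly_le -szt -szr.
  by rewrite max_poly_roots // Rpoly_neq0.
have eq : Rpoly R n.+1 = lead_coef (Rpoly R n.+1) *: \prod_(x <- r) ('X - x%:P).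
  by apply: all_roots_prod_XsubC; rewrite ?uniq_rootsE.
have lq : 0 < lead_coef (Rpoly R n.+1).
  (* The value at 0 is 1 and equals the leading coefficient times this product of the positive
     numbers [- x]. *)
  have prod0 : 0 < (\prod_(x <- r) ('X - x%:P)).[0].
    rewrite horner_prod big_seq; apply: prodr_gt0 => x /(allP rneg) x0.
    by rewrite !hornerE oppr_gt0.
  have := Rpoly_horner0 R n.+1; rewrite eq hornerZ lead_coefZ.
  rewrite (monicP (monic_prod_XsubC _ _ _)) mulr1 => e1.
  by rewrite -(pmulr_lgt0 _ prod0) e1.
exists r; split=> //; first by rewrite szr.
  move=> i ilt; rewrite -ts //; apply/ltW/lo; rewrite szt; move: ilt; rewrite sz.
  by move=> /leq_trans; apply; apply: half_leq.
move=> i ilt; rewrite szr in ilt; apply/ltW; rewrite -ts; first exact: hi.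
rewrite szt in ilt; rewrite sz; lia.
Qed.

Lemma Rpoly_simple_neg_roots n :
  exists2 s, size s = n./2 & simple_neg_roots (Rpoly R n) s.
Proof.
elim: n => [|n [s sz srs]]; last first.
  by have [r [? ? _ _]] := Rpoly_interlacing_step sz srs; exists r.
exists [::] => //; have e : Rpoly R 0 = 1.
  rewrite [LHS]size1_polyC ?size_Rpoly_le //.
  by rewrite -horner_coef0 Rpoly_horner0.
by split; rewrite // e lead_coef1 ?ltr01 // big_nil scale1r.
Qed.

Lemma simple_neg_roots_real_rooted p s : simple_neg_roots p s -> real_rooted p.
Proof.
case=> _ _ lp -> z; rewrite map_polyZ rootZ; last first.
  by rewrite fmorph_eq0 gt_eqF.
rewrite rmorph_prod (eq_bigr (fun x : R => 'X - (real_complex R x)%:P)); last first.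
  by move=> x _; rewrite rmorphB /= map_polyX map_polyC.
rewrite -(big_map (real_complex R) xpredT (fun w => 'X - w%:P)) root_prod_XsubC.
by move=> /mapP[x _ ->]; apply/complex_realP; exists x.
Qed.

Lemma simple_neg_roots_desc p s : simple_neg_roots p s -> roots_desc p s.
Proof.
case=> ss _ _ es; split=> //.
by apply: sub_sorted ss => x y; apply: ltW.
Qed.
End Sturm.

Theorem theorem3p7 (R : realType) :
  generalized_sturm (Rpoly R) /\ (forall n : nat, real_rooted (Rpoly R n)).
Proof.
have rR n : real_rooted (Rpoly R n).
  by have [s _ /simple_neg_roots_real_rooted] := Rpoly_simple_neg_roots R n.
split=> //; split=> // n.
  by right; have [s _ []] := Rpoly_simple_neg_roots R n.
have [s sz srs] := Rpoly_simple_neg_roots R n.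
have [r [szr rrs lo hi]] := Rpoly_interlacing_step sz srs.
constructor 1; split; first by split.
- by split; apply: Rpoly_nneg.
- rewrite (size_simple_neg_roots srs) (size_simple_neg_roots rrs) szr sz; lia.
- by exists s, r; split=> //; apply: simple_neg_roots_desc.
Qed.
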